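(* Let $\varphi$ be an unbounded lower semicontinuous submeasure on $\mathbb{N}$. Suppose there is $M>0$ such that the family $\mathcal{B}=\{A\subseteq\mathbb{N}:\varphi(A)\leq M\}$ is a covering of $\mathbb{N}$. Let $\{K_n:n\in\mathbb{N}\}$ be a strictly increasing (with respect to inclusion) sequence of nonempty finite sets such that $\bigcup_n K_n=\mathbb{N}$, and for each $n$ let $\mathcal{S}_n$ be a subfamily of $\mathcal{P}(K_n)\cap\mathcal{B}$ that covers $K_n$. Let $\delta_n=\delta(K_n,\mathcal{S}_n)$ be the covering number and $\delta=\inf\{\delta_n:n\in\mathbb{N}\}$. If $\delta>0$, then $\widehat{\varphi}$ is bounded and $P(\varphi)=\infty$.
   Context: A lower semicontinuous submeasure (lscsm) on $\mathbb{N}$ is a function $\varphi:\mathcal{P}(\mathbb{N})\to[0,\infty]$ with $\varphi(\emptyset)=0$, $\varphi(A)\leq\varphi(A\cup B)\leq\varphi(A)+\varphi(B)$ for all $A,B$, $\varphi(\{n\})<\infty$ for all $n$, and $\varphi(A)=\lim_{n\to\infty}\varphi(A\cap\{0,1,\dots,n\})$ for all $A$. It is unbounded if $\varphi(\mathbb{N})=\infty$. A measure here is a $\sigma$-additive measure $\mu$ on $\mathcal{P}(\mathbb{N})$; it is dominated by $\varphi$ if $\mu(A)\leq\varphi(A)$ for all $A$. Define $\widehat{\varphi}(A)=\sup\{\mu(A):\mu\text{ is a measure dominated by }\varphi\}$, and the degree of pathology $P(\varphi)=\sup\{\varphi(A)/\widehat{\varphi}(A):A\subseteq\mathbb{N}\text{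 finite},\ \widehat{\varphi}(A)\neq0\}$. For a nonempty finite set $K$ and a family $\mathcal{S}$ of subsets of $K$ covering $K$, let $m(K,\mathcal{S})=\min_{i\in K}|\{s\in\mathcal{S}:i\in s\}|$; the covering number is $\delta(K,\mathcal{S})=m(K,\mathcal{S})/|\mathcal{S}|$. *)

(* Defs.v *)
From HB Require Import structures.
From mathcomp Require Import all_boot all_order all_algebra finmap.
From mathcomp Require Import all_classical all_reals all_analysis.

Set Implicit Arguments.
Unset Strict Implicit.
Unset Printing Implicit Defensive.

Import Order.TTheory GRing.Theory Num.Theory.
Import numFieldNormedType.Exports.

Local Open Scope classical_set_scope.
Local Open Scope ring_scope.
Local Open Scope ereal_scope.

Record lscsm (R : realType) (phi : set nat -> \bar R) : Prop := Lscsm {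
  lscsm_ge0 : forall A, 0 <= phi A ;
  lscsm_set0 : phi set0 = 0 ;
  lscsm_mono : forall A B, phi A <= phi (A `|` B) ;
  lscsm_subadd : forall A B, phi (A `|` B) <= phi A + phi B ;
  lscsm_fin1 : forall n, phi [set n] < +oo ;
  (* [`I_n.+1] is {0, ..., n} *)
  lscsm_lsc : forall A, phi (A `&` `I_n.+1) @[n --> \oo] --> phi A }.

Definition bounded_submeasure (R : realType) (phi : set nat -> \bar R) : Prop :=
  phi setT < +oo.

Definition unbounded_submeasure (R : realType) (phi : set nat -> \bar R) : Prop :=
  phi setT = +oo.

(* In the library every subset of [nat] is measurable, so an element of
   [{measure set nat -> \bar R}] is a sigma-additive measure on P(N). *)
Definition dominated (R : realType) (phi : set nat -> \bar R)
    (mu : {measure set nat -> \bar R}) : Prop :=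
  forall A, mu A <= phi A.

Definition hat (R : realType) (phi : set nat -> \bar R) (A : set nat) : \bar R :=
  ereal_sup [set x | exists2 mu : {measure set nat -> \bar R},
                       dominated phi mu & x = mu A].

(* For finite [A], [hat phi A <= phi A < +oo] when [phi] is an lscsm, so the
   conventions of [\bar R] for division by 0 or by +oo are never used. *)
Definition pathology (R : realType) (phi : set nat -> \bar R) : \bar R :=
  ereal_sup [set phi A / hat phi A | A in
              [set A : set nat | finite_set A /\ hat phi A <> 0]].

Definition sublevel (R : realType) (phi : set nat -> \bar R) (M : R)
    : set (set nat) :=
  [set A | phi A <= M%:E].

Definition covers (T : choiceType) (K : {fset T}) (S : {fset {fset T}}) : Prop :=
  forall i, i \in K -> exists2 s, s \in S & i \in s.

(* The minimum over [K] of the number of members of [S] containing a point.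
   That number is at most [#|` S|], so for nonempty [K] the default value
   [#|` S|] does not affect the minimum. *)
Definition min_mult (T : choiceType) (K : {fset T}) (S : {fset {fset T}}) : nat :=
  \big[minn/#|` S|]_(i <- enum_fset K) #|` [fset s in S | i \in s]%fset|.

Definition covering_number (R : realType) (T : choiceType) (K : {fset T})
    (S : {fset {fset T}}) : R :=
  ((min_mult K S)%:R / (#|` S|)%:R)%R.

(* Main.v *)
Require Import Defs.
From HB Require Import structures.
From mathcomp Require Import all_boot all_order all_algebra finmap.
From mathcomp Require Import all_classical all_reals all_analysis.

Import Order.TTheory GRing.Theory Num.Theory.
Import numFieldNormedType.Exports.

Local Open Scope classical_set_scope.
Local Open Scope ring_scope.

(** Kelley's covering-number argument bounds every dominated measure by one
    constant.  If [mu] is dominated by [phi], then each member of [S n] has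
    [mu]-measure at most [M].  Counting in two ways the pairs (point of [K n],
    member of [S n] containing it), weighted by [mu], every point is met at
    least [min_mult (K n) (S n)] times, so
      [min_mult (K n) (S n) * mu (K n) <= M * #|S n|],
    that is, [mu (K n) <= M / delta_n <= M / delta].  Continuity from below
    along the [K n] gives [mu setT <= M / delta], a bound independent of [mu],
    so [hat phi] is bounded by [M / delta].

    On the other hand [phi] tends to infinity along the initial segments of
    [nat], by lower semicontinuity.  These sets eventually contain a
    point [k] with [phi [set k] != 0], and the Dirac mass at [k] with weight
    [phi [set k]] is dominated by [phi], so [hat phi] does not vanish on them
    and the quotients [phi / hat phi] there are unbounded. *)

Lemma min_mult_le (T : choiceType) (K : {fset T}) (S : {fset {fset T}}) i :
  i \in K -> (min_mult K S <= #|` [fset s in S | i \in s]%fset|)%N.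
Proof.
rewrite /min_mult -[i \in K]/(i \in enum_fset K).
elim: (enum_fset K) => // j r IHr; rewrite inE big_cons.
case/predU1P => [<-|/IHr le_i]; first exact: geq_minl.
exact: leq_trans (geq_minr _ _) le_i.
Qed.

Lemma sum_fset_sub (V : nmodType) (T : choiceType) (s K : {fset T})
    (f : T -> V) :
  (s `<=` K)%fset -> \sum_(i <- s) f i = \sum_(i <- K | i \in s) f i.
Proof.
move=> sK; rewrite -[RHS]big_filter; apply: perm_big; apply: uniq_perm.
- exact: fset_uniq.
- by rewrite filter_uniq// fset_uniq.
- move=> i; rewrite mem_filter; apply/idP/andP => [si|[]//].
  by split=> //; apply: (fsubsetP sK).
Qed.

(** The two-way count: exchanging the sums, each [f i] occurs on the right as
    often as there are members of [S] containing [i]. *)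
Lemma min_mult_sum_le (R : numDomainType) (T : choiceType) (K : {fset T})
    (S : {fset {fset T}}) (f : T -> R) :
  (forall i, 0 <= f i) -> (forall s, s \in S -> (s `<=` K)%fset) ->
  (min_mult K S)%:R * \sum_(i <- K) f i <= \sum_(s <- S) \sum_(i <- s) f i.
Proof.
move=> f_ge0 SK.
rewrite [leRHS](_ : _ = \sum_(s <- S) \sum_(i <- K | i \in s) f i); last first.
  by apply: eq_big_seq => s Ss; apply: sum_fset_sub; exact: SK.
rewrite (exchange_big_dep predT)//= mulr_sumr big_seq [leRHS]big_seq.
apply: ler_sum => i Ki; rewrite mulr_natl big_const_seq iter_addr_0.
apply: ler_wpMn2l => //.
apply: (leq_trans (min_mult_le _ _ _ _ Ki)).
rewrite -size_filter; apply: uniq_leq_size; first exact: fset_uniq.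
by move=> s; rewrite mem_filter !inE /= andbC.
Qed.

Lemma measure_fset (R : realType) (mu : {measure set nat -> \bar R})
    (s : {fset nat}) :
  mu [set` s] = (\sum_(i <- s) mu [set i])%E.
Proof.
rewrite -[X in mu X]image_id -bigcup_imset1 measure_fin_bigcup//.
- by rewrite fsbig_finite// set_fsetK.
- by move=> i j _ _ [x [-> ->]].
Qed.

Section Submeasure.
Context {R : realType} {phi : set nat -> \bar R}.

Lemma hat_mono (A B : set nat) : A `<=` B -> (hat phi A <= hat phi B)%E.
Proof.
move=> AB; apply: ge_ereal_sup => _ [mu dom ->].
apply: (@le_trans _ _ (mu B)); first by apply: le_measure; rewrite ?inE.
by apply: ereal_sup_ubound; exists mu.
Qed.

Hypothesis phi_lscsm : lscsm phi.

(** Apply the two-way count to the point masses of [mu], which are real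
    numbers because [phi] is finite on singletons: the right-hand side is a
    sum of [#|S|] measures, each at most [M]. *)
Lemma dominated_le_covering (mu : {measure set nat -> \bar R}) (M delta : R)
    (K : {fset nat}) (S : {fset {fset nat}}) :
  dominated phi mu -> 0 < delta -> delta <= covering_number R K S ->
  (forall s, s \in S -> (s `<=` K)%fset /\ sublevel phi M [set` s]) ->
  (mu [set` K] <= (M / delta)%:E)%E.
Proof.
move=> dom d0 dK SK; pose f i := fine (mu [set i]).
have fE i : mu [set i] = (f i)%:E.
  rewrite fineK// ge0_fin_numE//.
  exact: le_lt_trans (dom _) (lscsm_fin1 phi_lscsm i).
have muE (s : {fset nat}) : mu [set` s] = (\sum_(i <- s) f i)%:E.
  by rewrite measure_fset -sumEFin; apply: eq_bigr => i _; exact: fE.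
have f_ge0 i : 0 <= f i by rewrite /f fine_ge0.
(* For empty [S] the covering number is 0 / 0 = 0, contradicting [d0], [dK]. *)
have S_gt0 : 0 < (#|` S|)%:R :> R.
  rewrite lt0r ler0n andbT; apply/eqP => S0.
  by move: dK; rewrite /covering_number S0 invr0 mulr0 leNgt d0.
have S_le : \sum_(s <- S) \sum_(i <- s) f i <= (#|` S|)%:R * M.
  rewrite mulr_natl card_fset_sum1 -[leRHS]mulr_natl natr_sum mulr_suml.
  rewrite big_seq [leRHS]big_seq; apply: ler_sum => s Ss.
  by rewrite mul1r -lee_fin -muE (le_trans (dom _))//; have [] := SK _ Ss.
rewrite muE lee_fin ler_pdivlMr// -(ler_pM2l S_gt0) (le_trans _ S_le)//.
have SK1 s : s \in S -> (s `<=` K)%fset by case/SK.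
apply: le_trans (min_mult_sum_le _ _ _ _ _ f_ge0 SK1).
rewrite mulrCA mulrC ler_wpM2r ?sumr_ge0//.
by rewrite mulrC -ler_pdivlMr.
Qed.

(** If [phi] vanished on singletons, it would vanish on finite sets by
    subadditivity, and then everywhere by lower semicontinuity. *)
Lemma exists_phi_set1_gt0 : phi setT != 0%E -> exists k, (0 < phi [set k])%E.
Proof.
apply: contra_neqP => /forallNP phi1.
have phi0 k : phi [set k] = 0%E.
  apply/eqP; rewrite eq_le lscsm_ge0// andbT leNgt; exact/negP/phi1.
have phiI n : phi `I_n = 0%E.
  elim: n => [|n IHn]; first by rewrite II0 lscsm_set0.
  apply/eqP; rewrite eq_le lscsm_ge0// andbT IIS.
  by rewrite (le_trans (lscsm_subadd phi_lscsm _ _))// IHn phi0 adde0.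
have := @lscsm_lsc _ _ phi_lscsm setT; under eq_fun do rewrite setTI phiI.
by move/cvg_lim => <-//; rewrite lim_cst.
Qed.

(** Witnessed by the Dirac mass at [k] of weight [phi [set k]]. *)
Lemma phi_set1_le_hat (k : nat) (A : set nat) :
  A k -> (phi [set k] <= hat phi A)%E.
Proof.
move=> Ak; have phik : phi [set k] \is a fin_num.
  by rewrite ge0_fin_numE ?(lscsm_ge0 phi_lscsm)// (lscsm_fin1 phi_lscsm).
have w0 : 0 <= fine (phi [set k]) by rewrite fine_ge0// lscsm_ge0.
pose mu : {measure set nat -> \bar R} := mscale (NngNum w0) \d_k.
have muE B : mu B = (phi [set k] * (\1_B k)%:E)%E.
  by rewrite /mu/= /mscale/= fineK.
apply: ereal_sup_ubound; exists mu; last first.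
  by rewrite muE indicE mem_set// mule1.
move=> B; rewrite muE indicE; case: (pselect (B k)) => Bk; last first.
  by rewrite memNset// mule0 lscsm_ge0.
rewrite mem_set// mule1 (_ : B = [set k] `|` B) ?lscsm_mono//.
by apply/esym/setUidPr => _ ->.
Qed.

End Submeasure.

Theorem theorem3p9 (R : realType) (phi : set nat -> \bar R)
    (phi_lscsm : lscsm phi) (phi_unbounded : unbounded_submeasure phi)
    (M : R) (M_gt0 : 0 < M)
    (B_cover : \bigcup_(A in sublevel phi M) A = [set: nat])
    (K : nat -> {fset nat}) (K_neq0 : forall n, K n <> fset0)
    (K_incr : forall m n : nat, (m < n)%N -> (K m `<` K n)%fset)
    (K_cup : \bigcup_n [set` K n] = [set: nat])
    (S : nat -> {fset {fset nat}})
    (S_sub : forall n s, s \in S n ->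
       (s `<=` K n)%fset /\ sublevel phi M [set` s])
    (S_cover : forall n, covers (K n) (S n))
    (delta_gt0 : 0 < inf (range (fun n => covering_number R (K n) (S n)))) :
  bounded_submeasure (hat phi) /\ pathology phi = +oo%E.
Proof.
set delta := inf _ in delta_gt0.
have delta_le n : delta <= covering_number R (K n) (S n).
  apply: ge_inf; last by exists n.
  by exists 0 => _ [m _ <-]; rewrite /covering_number divr_ge0.
have hat_le : (hat phi setT <= (M / delta)%:E)%E.
  apply: ge_ereal_sup => _ [mu dom ->]; rewrite -K_cup.
  have K_nd : {homo (fun n => [set` K n]) : m n / (m <= n)%N >-> (m <= n)%O}.
    move=> m n; rewrite leq_eqVlt => /predU1P[->//|/K_incr/fproper_sub KK].
    by apply/subsetPset => i /=; apply: (fsubsetP KK).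
  have cvK : mu [set` K n] @[n --> \oo] --> mu (\bigcup_n [set` K n]).
    exact: nondecreasing_cvg_mu.
  rewrite -(cvg_lim _ cvK)//; apply: lime_le.
    by apply/cvg_ex; eexists; exact: cvK.
  apply: nearW => n.
  exact: dominated_le_covering dom delta_gt0 (delta_le n) (S_sub n).
split; first exact: le_lt_trans hat_le (ltry _).
have [k phik] : exists k, (0 < phi [set k])%E.
  by apply: exists_phi_set1_gt0 => //; rewrite phi_unbounded.
have phi_cvg : phi `I_n.+1 @[n --> \oo] --> +oo%E.
  have := @lscsm_lsc _ _ phi_lscsm setT; under eq_fun do rewrite setTI.
  by rewrite phi_unbounded.
apply: eq_infty => r.
have [n [kn rn]] : exists n, (k <= n)%N /\
    ((`|r| * (M / delta))%:E <= phi `I_n.+1)%E.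
  have [N _ HN] : \forall n \near \oo,
      ((`|r| * (M / delta))%:E <= phi `I_n.+1)%E.
    by move/cvgeyPge: phi_cvg; apply.
  by exists (maxn k N); split; [exact: leq_maxl|apply: HN; exact: leq_maxr].
have hatk : (phi [set k] <= hat phi `I_n.+1)%E.
  by apply: phi_set1_le_hat => //=; rewrite ltnS.
have hat_gt0 := lt_le_trans phik hatk.
have hat_n : (hat phi `I_n.+1 <= (M / delta)%:E)%E.
  exact: le_trans (hat_mono _ _ (@subsetT _ _)) hat_le.
apply: (@le_trans _ _ (phi `I_n.+1 / hat phi `I_n.+1)%E); last first.
  apply: ereal_sup_ubound; exists `I_n.+1 => //; split; first exact: finite_II.
  by move=> h0; rewrite h0 ltxx in hat_gt0.
move: (hat phi `I_n.+1) hat_gt0 hat_n => [h||]//; rewrite lte_fin lee_fin.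
move=> h_gt0 h_le; rewrite inver gt_eqF// lee_pdivlMr//.
apply: le_trans rn; rewrite -EFinM lee_fin.
by apply: (@le_trans _ _ (`|r| * h)); rewrite ?ler_wpM2r ?ler_wpM2l ?ler_norm// ltW.
Qed.
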